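(* If $G$ and $H$ are semiprime skew braces, then their wreath product $G \wr H$ is also a semiprime skew brace.
   Context: A skew brace is a triple $(A,+,\circ)$ such that $(A,+)$ and $(A,\circ)$ are groups (neither necessarily abelian) and $a\circ(b+c)=a\circ b-a+a\circ c$ for all $a,b,c\in A$. The identities $0$ of $(A,+)$ and $1$ of $(A,\circ)$ coincide. A sub skew brace is a subset that is a subgroup with respect to both operations. For $a\in A$, define $\lambda_a\colon A\to A$ by $\lambda_a(b)=-a+a\circ b$, and define $a*b=\lambda_a(b)-b$. For subsets $B,C\subseteq A$, $B*C$ denotes the sub skew brace of $A$ generated by $\{b*c : b\in B, c\in C\}$. An ideal of $A$ is a normal subgroup $I$ of $(A,\circ)$ such that $\lambda_a(I)\subseteq I$ and $a+I=I+a$ for all $a\in A$. A skew brace $A$ is semiprime if the only ideal $I$ of $A$ with $I*I=0$ (i.e. $I*I=\{0\}$) is the zero ideal $\{0\}$. $\operatorname{Aut}_{\mathrm{Sk}}(G)$ denotes the group of skew brace automorphisms of $G$ (bijections preserving both operations). For skew braces $G,H$ and a group homomorphism $\sigma\colon (H,\circ)\to \operatorname{Aut}_{\mathrm{Sk}}(G)$, the semidirect product $G\rtimes H$ via $\sigma$ is the skew brace on the set $G\times H$ with operations $(g_1,h_1)+(g_2,h_2)=(g_1+g_2,h_1+h_2)$ and $(g_1,h_1)\circ(g_2,h_2)=(g_1\circ\sigma(h_1)(g_2),h_1\circ h_2)$. Wreath product: for skew braces $G,H$, let $W=\{f\colon H\to G \text{ such that } |\{h\in H : f(h)\neq 1\}|<\infty\}$,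 a skew brace under the pointwise operations $(f_1+f_2)(h)=f_1(h)+f_2(h)$ and $(f_1\circ f_2)(h)=f_1(h)\circ f_2(h)$. The wreath product $G\wr H$ is the semidirect product $W\rtimes H$ via $\sigma\colon H\to\operatorname{Aut}_{\mathrm{Sk}}(W)$ given by $\sigma(h)(f)(x)=f(x\circ h)$ for all $x,h\in H$, $f\in W$. *)

(* Defs.v *)
From mathcomp Require Import all_boot.
From mathcomp Require Import boolp classical_sets functions cardinality.

Set Implicit Arguments.
Unset Strict Implicit.
Unset Printing Implicit Defensive.

Local Open Scope classical_set_scope.

(* [groupType] bundles one fixed multiplicative law with a [choiceType]; a skew
   brace needs two (non-commutative) group laws on the same arbitrary type. *)
Record groupLaw (T : Type) := GroupLaw {
  gop : T -> T -> T;
  gunit : T;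
  ginv : T -> T;
  gopA : associative gop;
  gop1 : left_id gunit gop;
  gopr1 : right_id gunit gop;
  gopV : left_inverse gunit ginv gop;
  goprV : right_inverse gunit ginv gop }.

Definition is_group_hom (T U : Type) (g : groupLaw T) (k : groupLaw U)
    (f : T -> U) : Prop :=
  forall x y, f (gop g x y) = gop k (f x) (f y).

Definition is_subgroup (T : Type) (g : groupLaw T) (S : set T) : Prop :=
  [/\ S (gunit g),
      forall x y, S x -> S y -> S (gop g x y) &
      forall x, S x -> S (ginv g x)].

Definition is_normal_subgroup (T : Type) (g : groupLaw T) (S : set T) : Prop :=
  is_subgroup g S /\
  forall a x, S x -> S (gop g (gop g a x) (ginv g a)).

Record skewBrace := SkewBrace {
  sbcar :> Type;
  addg : groupLaw sbcar;
  circg : groupLaw sbcar;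
  sb_distr : forall a b c,
    gop circg a (gop addg b c) =
    gop addg (gop addg (gop circg a b) (ginv addg a)) (gop circg a c) }.

Declare Scope skew_brace_scope.
Delimit Scope skew_brace_scope with SB.
Notation "a + b" := (gop (addg _) a b) : skew_brace_scope.
Notation "- a" := (ginv (addg _) a) : skew_brace_scope.
Notation "a - b" := (gop (addg _) a (ginv (addg _) b)) : skew_brace_scope.
Notation "0" := (gunit (addg _)) : skew_brace_scope.
Notation "a \circ b" := (gop (circg _) a b)
  (at level 40, left associativity) : skew_brace_scope.
Notation "a ^-1" := (ginv (circg _) a) : skew_brace_scope.
Notation "1" := (gunit (circg _)) : skew_brace_scope.
Local Open Scope skew_brace_scope.

Section SkewBraceTheory.
Variable A : skewBrace.
Implicit Types (a b c : A) (B C I S : set A).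

Definition lambda a b : A := - a + (a \circ b).

Definition star a b : A := lambda a b - b.

Definition is_sub_skew_brace S : Prop :=
  is_subgroup (addg A) S /\ is_subgroup (circg A) S.

Definition star_set B C : set A :=
  smallest is_sub_skew_brace [set star b c | b in B & c in C].

Definition is_ideal I : Prop :=
  [/\ is_normal_subgroup (circg A) I,
      forall a, [set lambda a x | x in I] `<=` I &
      forall a, [set a + x | x in I] = [set x + a | x in I]].

Definition semiprime : Prop :=
  forall I, is_ideal I -> star_set I I = [set 0] -> I = [set 0].

Lemma sb_addI a : injective (gop (addg A) a).
Proof.
by move=> x y e; rewrite -[x](gop1 (addg A)) -(gopV (addg A) a) -gopA e gopA
  gopV gop1.
Qed.

Lemma sb_zero_one : (0 : A) = 1.
Proof.
have := sb_distr 1 (0 : A) 0.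
rewrite gop1 !(gop1 (circg A)) gop1 gopr1 gop1 => e.
by apply: (@sb_addI (- (1 : A))); rewrite gopV gopr1 -e.
Qed.

End SkewBraceTheory.

Section Automorphisms.
Variable G : skewBrace.

Record skAut := SkAut {
  aut_fun :> G -> G;
  aut_bij : bijective aut_fun;
  aut_add : forall x y, aut_fun (x + y) = aut_fun x + aut_fun y;
  aut_circ : forall x y,
    aut_fun (x \circ y) = aut_fun x \circ aut_fun y }.

Lemma skAut_eq (s t : skAut) : (forall x, s x = t x) -> s = t.
Proof.
case: s t => [f bf af cf] [g bg ag cg] /= /funext e; subst g.
by congr SkAut; apply: Prop_irrelevance.
Qed.

Definition skAut_id : skAut.
Proof. by exists id => //; exists id. Defined.

Definition skAut_comp (s t : skAut) : skAut.
Proof.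
exists (s \o t) => [|x y|x y] /=.
- exact: bij_comp (aut_bij s) (aut_bij t).
- by rewrite !aut_add.
- by rewrite !aut_circ.
Defined.

Lemma skAut_inv_ex (s : skAut) : exists g : G -> G, cancel s g /\ cancel g s.
Proof. by case: (aut_bij s) => g gK sK; exists g. Qed.

Definition skAut_inv_fun (s : skAut) : G -> G := sval (cid (skAut_inv_ex s)).

Lemma skAut_invK (s : skAut) : cancel (skAut_inv_fun s) s.
Proof. by rewrite /skAut_inv_fun; case: cid => g []. Qed.

Lemma skAut_Kinv (s : skAut) : cancel s (skAut_inv_fun s).
Proof. by rewrite /skAut_inv_fun; case: cid => g []. Qed.

Definition skAut_inv (s : skAut) : skAut.
Proof.
exists (skAut_inv_fun s) => [|x y|x y].
- by exists s; [apply: skAut_invK | apply: skAut_Kinv].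
- by apply: (can_inj (skAut_Kinv s)); rewrite aut_add !skAut_invK.
- by apply: (can_inj (skAut_Kinv s)); rewrite aut_circ !skAut_invK.
Defined.

Definition AutSk : groupLaw skAut.
Proof.
exists skAut_comp skAut_id skAut_inv.
- by move=> s t u; apply: skAut_eq.
- by move=> s; apply: skAut_eq.
- by move=> s; apply: skAut_eq.
- by move=> s; apply: skAut_eq => x /=; apply: skAut_Kinv.
- by move=> s; apply: skAut_eq => x /=; apply: skAut_invK.
Defined.

End Automorphisms.

Section SemidirectProduct.
Variables (G H : skewBrace) (sigma : H -> skAut G).
Hypothesis sigmaM : is_group_hom (circg H) (AutSk G) sigma.

Let sigmaME h1 h2 g : sigma (h1 \circ h2) g = sigma h1 (sigma h2 g).
Proof. by rewrite sigmaM. Qed.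

Let sigma1 g : sigma 1 g = g.
Proof.
by apply: (bij_inj (aut_bij (sigma 1))); rewrite -sigmaME gop1.
Qed.

Let aut1 (s : skAut G) : s 1 = 1.
Proof.
have e : s 1 \circ s 1 = s 1 by rewrite -aut_circ gop1.
by have := congr1 (gop (circg G) ((s 1)^-1)) e; rewrite gopA !gopV gop1.
Qed.

Definition sdp_add : groupLaw (G * H).
Proof.
exists (fun p q => (p.1 + q.1, p.2 + q.2)) (0, 0) (fun p => (- p.1, - p.2)).
- by move=> ? ? ? /=; rewrite !gopA.
- by move=> [? ?] /=; rewrite !gop1.
- by move=> [? ?] /=; rewrite !gopr1.
- by move=> [? ?] /=; rewrite !gopV.
- by move=> [? ?] /=; rewrite !goprV.
Defined.

Definition sdp_circ : groupLaw (G * H).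
Proof.
exists (fun p q => (p.1 \circ sigma p.2 q.1, p.2 \circ q.2)) (1, 1)
  (fun p => (sigma (p.2^-1) (p.1^-1), p.2^-1)).
- by move=> ? ? ? /=; rewrite aut_circ sigmaME !gopA.
- by move=> [? ?] /=; rewrite sigma1 !gop1.
- by move=> [? ?] /=; rewrite aut1 !gopr1.
- by move=> [? ?] /=; rewrite -aut_circ !gopV aut1.
- by move=> [? ?] /=; rewrite -sigmaME !goprV sigma1 goprV.
Defined.

Definition semidirect : skewBrace.
Proof.
exists (G * H)%type sdp_add sdp_circ.
by move=> [? ?] [? ?] [? ?] /=; rewrite aut_add !sb_distr.
Defined.

End SemidirectProduct.

Section WreathProduct.
Variables G H : skewBrace.

Record finsupp := Finsupp {
  fs_fun :> H -> G;
  fs_finite : finite_set [set h | fs_fun h <> 1] }.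

Lemma finsupp_eq (f g : finsupp) : (forall h, f h = g h) -> f = g.
Proof.
case: f g => [f pf] [g pg] /= /funext e; subst g.
by congr Finsupp; apply: Prop_irrelevance.
Qed.

Lemma finsupp_op (op : G -> G -> G) (f g : finsupp) : op 1 1 = 1 ->
  finite_set [set h | op (f h) (g h) <> 1].
Proof.
move=> op1; have := fs_finite f; have := fs_finite g => fg ff.
apply: (sub_finite_set (B := [set h | f h <> 1] `|` [set h | g h <> 1])).
  move=> h /= ne; apply: contrapT => /not_orP[/contrapT e1 /contrapT e2].
  by apply: ne; rewrite e1 e2.
by rewrite finite_setU.
Qed.

Lemma finsupp_cst1 : finite_set [set h : H | (fun=> 1 : G) h <> 1].
Proof. by rewrite (_ : [set h | _] = set0) // -subset0 => h /=. Qed.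

Lemma add11 : (1 + 1 : G) = 1.
Proof. by rewrite -sb_zero_one gop1. Qed.

Lemma opp1 : - (1 : G) = 1.
Proof. by rewrite -sb_zero_one -[LHS](gop1 (addg G)) goprV. Qed.

Lemma inv1 : (1^-1 : G) = 1.
Proof. by rewrite -[LHS](gop1 (circg G)) goprV. Qed.

Definition fs_one : finsupp := Finsupp finsupp_cst1.

Definition fs_add (f g : finsupp) : finsupp :=
  Finsupp (finsupp_op f g add11).

Definition fs_opp (f : finsupp) : finsupp :=
  Finsupp (finsupp_op (op := fun x _ => - x) f f opp1).

Definition fs_circ (f g : finsupp) : finsupp :=
  Finsupp (finsupp_op f g (gop1 (circg G) 1)).

Definition fs_inv (f : finsupp) : finsupp :=
  Finsupp (finsupp_op (op := fun x _ => x^-1) f f inv1).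

(* The zero of [finsupp] is the constant function 1, which is also the constant
   function 0 by [sb_zero_one]. *)
Definition fs_addg : groupLaw finsupp.
Proof.
exists fs_add fs_one fs_opp.
- by move=> ? ? ?; apply: finsupp_eq => h /=; rewrite gopA.
- by move=> ?; apply: finsupp_eq => h /=; rewrite -sb_zero_one gop1.
- by move=> ?; apply: finsupp_eq => h /=; rewrite -sb_zero_one gopr1.
- by move=> ?; apply: finsupp_eq => h /=; rewrite -sb_zero_one gopV.
- by move=> ?; apply: finsupp_eq => h /=; rewrite -sb_zero_one goprV.
Defined.

Definition fs_circg : groupLaw finsupp.
Proof.
exists fs_circ fs_one fs_inv.
- by move=> ? ? ?; apply: finsupp_eq => h /=; rewrite gopA.
- by move=> ?; apply: finsupp_eq => h /=; rewrite gop1.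
- by move=> ?; apply: finsupp_eq => h /=; rewrite gopr1.
- by move=> ?; apply: finsupp_eq => h /=; rewrite gopV.
- by move=> ?; apply: finsupp_eq => h /=; rewrite goprV.
Defined.

Definition finsupp_skewBrace : skewBrace.
Proof.
exists finsupp fs_addg fs_circg.
by move=> ? ? ?; apply: finsupp_eq => h /=; rewrite sb_distr.
Defined.

Lemma fs_shift_finite (h : H) (f : finsupp) :
  finite_set [set x | f (x \circ h) <> 1].
Proof.
have := finite_image (fun x => x \circ h^-1) (fs_finite f).
apply: sub_finite_set => x /= ne; exists (x \circ h) => //.
by rewrite -gopA goprV gopr1.
Qed.

Definition fs_shift (h : H) (f : finsupp) : finsupp :=
  Finsupp (fs_shift_finite h f).

Definition wreath_action (h : H) : skAut finsupp_skewBrace.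
Proof.
exists (fs_shift h : finsupp_skewBrace -> finsupp_skewBrace).
- exists (fs_shift (h^-1)) => f; apply: finsupp_eq => x /=.
    by rewrite -gopA gopV gopr1.
  by rewrite -gopA goprV gopr1.
- by move=> f g; apply: finsupp_eq.
- by move=> f g; apply: finsupp_eq.
Defined.

Lemma wreath_actionM :
  is_group_hom (circg H) (AutSk finsupp_skewBrace) wreath_action.
Proof.
move=> h1 h2; apply: skAut_eq => f; apply: finsupp_eq => x /=.
by rewrite gopA.
Qed.

Definition wreath : skewBrace := semidirect wreath_actionM.

End WreathProduct.

(* Main.v *)
(* A surjective homomorphism from A onto a semiprime skew brace kills every
   ideal I of A with I * I = 0, because the image of I is again such an ideal.
   In a semidirect product this applies first to the projection onto H, which
   forces I into G, and then to G itself; in the brace of finitely supported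
   functions it applies to each evaluation map. *)
From mathcomp Require Import all_boot.
From mathcomp Require Import boolp classical_sets cardinality.
Require Import Defs.

Set Implicit Arguments.
Unset Strict Implicit.
Unset Printing Implicit Defensive.

Local Open Scope classical_set_scope.
Local Open Scope skew_brace_scope.

Lemma gopI (T : Type) (g : groupLaw T) (a : T) : injective (gop g a).
Proof. by move=> x y e; rewrite -[x](gop1 g) -(gopV g a) -gopA e gopA gopV gop1. Qed.

Section GroupHom.
Variables (T U : Type) (g : groupLaw T) (k : groupLaw U) (f : T -> U).
Hypothesis fM : is_group_hom g k f.

Lemma group_hom1 : f (gunit g) = gunit k.
Proof. by apply: (@gopI _ k (f (gunit g))); rewrite -fM gop1 gopr1. Qed.

Lemma group_homV x : f (ginv g x) = ginv k (f x).
Proof. by apply: (@gopI _ k (f x)); rewrite -fM !goprV group_hom1. Qed.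

(** Surjectivity is what yields normality: every conjugating element of [U] lifts to [T], where [S]
    is closed under conjugation. *)
Lemma normal_subgroup_image (S : set T) : (forall y, exists x, f x = y) ->
  is_normal_subgroup g S -> is_normal_subgroup k (f @` S).
Proof.
move=> f_surj [[S1 SM SV] SJ]; split; first split.
- by exists (gunit g) => //; exact: group_hom1.
- by move=> _ _ [x Sx <-] [y Sy <-]; exists (gop g x y); [exact: SM|exact: fM].
- by move=> _ [x Sx <-]; exists (ginv g x); [exact: SV|exact: group_homV].
- move=> b _ [x Sx <-]; have [a <-] := f_surj b.
  by exists (gop g (gop g a x) (ginv g a)); rewrite ?fM ?group_homV //; exact: SJ.
Qed.

Lemma normal_subgroup_preimage (S : set U) :
  is_normal_subgroup k S -> is_normal_subgroup g (f @^-1` S).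
Proof.
move=> [[S1 SM SV] SJ]; split; first split.
- by rewrite /preimage /= group_hom1.
- by move=> x y Sx Sy; rewrite /preimage /= fM; exact: SM.
- by move=> x Sx; rewrite /preimage /= group_homV; exact: SV.
- by move=> a x Sx; rewrite /preimage /= !fM group_homV; exact: SJ.
Qed.

End GroupHom.

Lemma ideal_zero (A : skewBrace) (I : set A) : is_ideal I -> I 0.
Proof. by rewrite sb_zero_one => -[[[]]]. Qed.

Lemma zero_sub_skew_brace (A : skewBrace) : is_sub_skew_brace [set (0 : A)].
Proof.
split; split=> //=.
- by move=> _ _ -> ->; rewrite gop1.
- by move=> _ ->; rewrite -[LHS](gop1 (addg A)) goprV.
- by rewrite sb_zero_one.
- by move=> _ _ -> ->; rewrite [in LHS]sb_zero_one gop1 sb_zero_one.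
- by move=> _ ->; rewrite sb_zero_one -[LHS](gop1 (circg A)) goprV.
Qed.

(** Since [[set 0]] is itself a sub skew brace, the one generated by the stars is trivial exactly
    when all generators vanish. This replaces generation by an elementwise condition that
    homomorphisms transport. *)
Lemma star_set_eq0P (A : skewBrace) (B C : set A) :
  star_set B C = [set 0] <-> forall b c, B b -> C c -> star b c = 0.
Proof.
split=> [e b c Bb Cc|e].
  suff: star_set B C (star b c) by rewrite e.
  by apply: sub_gen_smallest; exists b => //; exists c.
apply/seteqP; split=> [x|_ ->].
  apply: smallest_sub; first exact: zero_sub_skew_brace.
  by move=> _ [b Bb [c Cc <-]]; exact: e.
by move=> S [[[]]].
Qed.

Section SkewBraceHom.
Variables (A B : skewBrace) (f : A -> B).
Hypotheses (fD : is_group_hom (addg A) (addg B) f)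
           (fM : is_group_hom (circg A) (circg B) f).

Lemma sb_hom_lambda a b : f (lambda a b) = lambda (f a) (f b).
Proof. by rewrite /lambda fD (group_homV fD) fM. Qed.

Lemma sb_hom_star a b : f (star a b) = star (f a) (f b).
Proof. by rewrite /star fD sb_hom_lambda (group_homV fD). Qed.

Lemma ideal_image (I : set A) : (forall y, exists x, f x = y) ->
  is_ideal I -> is_ideal (f @` I).
Proof.
move=> f_surj [In Il Ic]; split; first exact: normal_subgroup_image.
  move=> b _ [_ [x Ix <-] <-]; have [a <-] := f_surj b.
  by exists (lambda a x); [apply: (Il a); exists x|exact: sb_hom_lambda].
(* Once [b] is lifted to [a], an equality between left and right translates by [a] in [A] is pushed
   forward along [f]. *)
move=> b; have [a <-] := f_surj b; apply/seteqP; split=> [|] _ [_ [x Ix <-] <-].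
- have : [set x + a | x in I] (a + x) by rewrite -Ic; exists x.
  by case=> y Iy e; exists (f y); [exists y|rewrite -!fD e].
- have : [set a + x | x in I] (x + a) by rewrite Ic; exists x.
  by case=> y Iy e; exists (f y); [exists y|rewrite -!fD e].
Qed.

Lemma ideal_preimage (I : set B) : is_ideal I -> is_ideal (f @^-1` I).
Proof.
move=> [In Il Ic]; split; first exact: (normal_subgroup_preimage fM In).
  move=> a _ [x Ix <-]; rewrite /preimage /= sb_hom_lambda.
  by apply: (Il (f a)); exists (f x).
move=> a; apply/seteqP; split=> [|] _ [x Ix <-].
- have : [set x + f a | x in I] (f a + f x) by rewrite -Ic; exists (f x).
  (* The witness is forced by the equation [z + a = a + x]. By [e] its image under [f] is [y], which
     lies in [I]. *)
  case=> y Iy e; exists (a + x - a); last by rewrite -gopA gopV gopr1.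
  by rewrite /preimage /= !fD (group_homV fD) -e -gopA goprV gopr1.
- have : [set f a + x | x in I] (f x + f a) by rewrite Ic; exists (f x).
  case=> y Iy e; exists (- a + (x + a)); last by rewrite gopA goprV gop1.
  by rewrite /preimage /= !fD (group_homV fD) -e gopA gopV gop1.
Qed.

Lemma semiprime_hom_eq0 (I : set A) : (forall y, exists x, f x = y) ->
  semiprime B -> is_ideal I -> star_set I I = [set 0] ->
  forall x, I x -> f x = 0.
Proof.
move=> f_surj sB II /star_set_eq0P I0 x Ix.
suff e : f @` I = [set 0].
  by have : (f @` I) (f x); [exists x|rewrite e].
apply: sB; first exact: ideal_image.
apply/star_set_eq0P => _ _ [y Iy <-] [z Iz <-].
by rewrite -sb_hom_star I0 // (group_hom1 fD).
Qed.

End SkewBraceHom.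

Section SemidirectProduct.
Variables (G H : skewBrace) (sigma : H -> skAut G).
Hypothesis sigmaM : is_group_hom (circg H) (AutSk G) sigma.

Definition sdp_inl (g : G) : semidirect sigmaM := (g, 1).

Lemma sdp_inlD : is_group_hom (addg G) (addg (semidirect sigmaM)) sdp_inl.
Proof. by move=> x y; rewrite /sdp_inl /= -sb_zero_one gop1. Qed.

(** The action does not twist the product on this copy of [G], because [sigma 1] is the identity
    automorphism. *)
Lemma sdp_inlM : is_group_hom (circg G) (circg (semidirect sigmaM)) sdp_inl.
Proof. by move=> x y; rewrite /sdp_inl /= (group_hom1 sigmaM) gop1. Qed.

Lemma semiprime_semidirect :
  semiprime G -> semiprime H -> semiprime (semidirect sigmaM).
Proof.
move=> sG sH I II I0.
have I2 (p : semidirect sigmaM) : I p -> p.2 = 0.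
  apply: (@semiprime_hom_eq0 (semidirect sigmaM) H (fun p => p.2) _ _ I) => // h.
  by exists (1, h).
(* [sdp_inl] preserves stars and is injective, so stars that vanish in the product already vanish in
   [G]; injectivity enters by taking first components. *)
have J0 : sdp_inl @^-1` I = [set 0].
  apply: sG; first exact: (ideal_preimage sdp_inlD sdp_inlM II).
  apply/star_set_eq0P => x y Ix Iy.
  have /star_set_eq0P/(_ _ _ Ix Iy) := I0.
  by rewrite -(sb_hom_star sdp_inlD sdp_inlM) => /(congr1 fst).
apply/seteqP; split=> [[g h] Igh|_ ->]; last exact: ideal_zero.
(* With second component [0], which is also [1], the element lies in the range of [sdp_inl], so [J0]
   applies to [g]. *)
have /= h0 := I2 _ Igh; subst h.
suff -> : g = 0 by [].
have : (sdp_inl @^-1` I) g by rewrite /preimage /sdp_inl /= -sb_zero_one.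
by rewrite J0.
Qed.

End SemidirectProduct.

(** The function with value [g] at [h] and [1] elsewhere works; equality on [H] is decided
    classically. *)
Lemma finsupp_eval_surj (G H : skewBrace) (h : H) (g : G) :
  exists f : finsupp G H, f h = g.
Proof.
have fin : finite_set [set x | (if `[< x = h >] then g else 1) <> 1].
  apply: (sub_finite_set (B := [set h])); last exact: finite_set1.
  by move=> x /=; case: asboolP.
by exists (Finsupp fin) => /=; case: asboolP.
Qed.

Lemma semiprime_finsupp (G H : skewBrace) :
  semiprime G -> semiprime (finsupp_skewBrace G H).
Proof.
move=> sG I II I0; apply/seteqP; split=> [f If|_ ->]; last exact: ideal_zero.
(* The zero function is encoded as the constant [1], so its value is turned back into [0] before
   evaluation at [h] is used. *)
apply: finsupp_eq => h /=; rewrite -sb_zero_one.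
apply: (@semiprime_hom_eq0 (finsupp_skewBrace G H) G (fun f => fs_fun f h) _ _ I)
  => //.
exact: finsupp_eval_surj.
Qed.

Theorem theorem3p3 (G H : skewBrace) :
  semiprime G -> semiprime H -> semiprime (wreath G H).
Proof.
by move=> sG sH; apply: semiprime_semidirect => //; exact: semiprime_finsupp.
Qed.
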